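(* Let $p>1$. Suppose that $\mathcal{G}=(V,E)$ is a connected graph with $\beta=|E|-|V|+1$ independent loops, and let $\lambda_1\le\dots\le\lambda_N$ be the variational eigenvalues of a generalized $p$-Laplacian $\mathcal{H}_p$ on $\mathcal{G}$. For a function $f:V\to\mathbb{R}$, let $\nu(f)$ be the number of nodal domains induced by $f$, $l(f)$ the number of independent loops in $\mathcal{G}$ where $f$ has constant sign, and $\{v_i\}_{i=1}^{z(f)}$ the nodes such that $f(v_i)=0$, with $z(f)$ the number of such nodes. Let $\mathcal{G}'=(V',E')=\mathcal{G}\setminus\{v_i\}_{i=1}^{z(f)}$ be the graph obtained by removing from $\mathcal{G}$ all the nodes where $f$ is zero as well as all the edges connected to those nodes. Let $c(f)$ be the number of connected components of $\mathcal{G}'$ and $\beta'(f)=|E'|-|V'|+c(f)$ the number of independent loops of $\mathcal{G}'$. Then: 1. If $f$ is an eigenfunction of $\mathcal{H}_p$ with eigenvalue $\lambda$ such that $\lambda>\lambda_k$, then $f$ induces strictly more than $k-\beta+l(f)-z(f)$ nodal domains. Precisely, $\nu(f)\ge k-\beta'(f)+l(f)-z(f)+c(f)$. 2. If $f$ is an eigenfunction of $\mathcal{H}_p$ corresponding to the variational eigenvalue $\lambda_k>\lambda_{k-1}$ with $\mathrm{mult}_{\mathcal{H}_p}(\lambda_k)=m$, then $\nu(f)\ge k+m-1-\beta'(f)+l(f)-z(f)$.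
   Context: Let $\mathcal{G}=(V,E)$ be a finite undirected simple graph with $N=|V|$ nodes, positive node weights $\varrho:V\to\mathbb{R}_+$ and positive symmetric edge weights $\omega:E\to\mathbb{R}_+$; $v\sim u$ means that $uv\in E$. For $p>1$ put $\phi_p(x)=|x|^{p-2}x$ (with $\phi_p(0)=0$). Given real coefficients $\kappa_u$, $u\in V$, the generalized $p$-Laplacian is $(\mathcal{H}_p f)(u)=\sum_{v\sim u}\omega_{uv}\phi_p(f(u)-f(v))+\kappa_u\phi_p(f(u))$ for $f:V\to\mathbb{R}$. A nonzero $f$ is an eigenfunction with eigenvalue $\lambda\in\mathbb{R}$ if $(\mathcal{H}_pf)(u)=\lambda\varrho_u\phi_p(f(u))$ for all $u\in V$. Krasnoselskii genus: for a closed symmetric set $A=-A$ in $\mathbb{R}^N$, $\gamma(A)$ is the least $k\in\mathbb{N}$ such that there is a continuous odd map $\varphi:A\to\mathbb{R}^k$ with $0\notin\varphi(A)$; $\gamma(A)=\infty$ if no such $k$ exists and $\gamma(\emptyset)=0$. Let $\mathcal{S}_p=\{f:V\to\mathbb{R}:\|f\|_p=1\}$, $\mathcal{F}_k(\mathcal{S}_p)=\{A\subseteq\mathcal{S}_p: A=-A \text{ closed},\ \gamma(A)\ge k\}$, and $$\mathcal{R}_{\mathcal{H}_p}(f)=\frac{\sum_{uv\in E}\omega_{uv}|f(u)-f(v)|^p+\sum_{u\in V}\kappa_u|f(u)|^p}{\sum_{u\in V}\varrho_u|f(u)|^p}.$$ The variational eigenvalues are $\lambda_k=\min_{A\in\mathcal{F}_k(\mathcal{S}_p)}\max_{f\in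 A}\mathcal{R}_{\mathcal{H}_p}(f)$, $k=1,\dots,N$, so $\lambda_1\le\dots\le\lambda_N$; for $k=1$ the condition $\lambda_k>\lambda_{k-1}$ is void. $\mathrm{mult}_{\mathcal{H}_p}(\lambda)$ is the number of times $\lambda$ appears in the sequence $\lambda_1,\dots,\lambda_N$. A nodal domain induced by $f$ is (the vertex set of) a maximal connected subgraph of $\mathcal{G}$ on which $f$ is nonzero and has constant sign. The number of independent loops of a graph is its cycle rank (number of edges minus number of nodes plus number of connected components). The number $l(f)$ of independent loops where $f$ has constant sign is the cycle rank of the subgraph of $\mathcal{G}$ formed by the edges $uv$ with $f(u)f(v)>0$ (equivalently, the sum of the cycle ranks of the subgraphs induced on the nodal domains of $f$). *)

(* Defs.v *)
From HB Require Import structures.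
From mathcomp Require Import all_boot all_order all_algebra.

Set Implicit Arguments.
Unset Strict Implicit.
Unset Printing Implicit Defensive.

Import Order.TTheory GRing.Theory Num.Theory.

Local Open Scope ring_scope.

(* A finite simple graph on the finType [V] is a symmetric irreflexive
   [e : rel V]; edge weights are a function [omega : V -> V -> R] of which only
   the values on adjacent pairs matter. *)

Section Graph.
Context (V : finType).
Implicit Types (r : rel V) (A : {set V}).

(* Edges are counted as unordered pairs. *)
Definition edge_count r : nat :=
  #|[set [set x.1; x.2] | x : V * V & r x.1 x.2]|.

Definition induced r A : rel V := [rel u v | [&& r u v, u \in A & v \in A]].

(* Cycle rank of the graph with vertex set [A] and edge relation [r], for a
   symmetric irreflexive [r] joining only vertices of [A]. *)
Definition cycle_rank A r : int :=
  (edge_count r)%:Z - #|A|%:Z + (n_comp r A)%:Z.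

Definition connected_graph r : Prop := forall u v : V, connect r u v.

Definition connected_set r A : bool :=
  (A != set0) && [forall u in A, forall v in A, connect (induced r A) u v].

End Graph.

Section Nodal.
Context (R : realDomainType) (V : finType) (e : rel V).
Implicit Types f : V -> R.

Definition const_sign f (A : {set V}) : bool :=
  [forall u in A, 0 < f u] || [forall u in A, f u < 0].

Definition nodal_domains f : {set {set V}} :=
  [set A | maxset (fun B => connected_set e B && const_sign f B) A].

Definition nodal_count f : nat := #|nodal_domains f|.

Definition zero_count f : nat := #|[set u | f u == 0]|.

Definition nonzero_set f : {set V} := [set u | f u != 0].

Definition nonzero_edges f : rel V := induced e (nonzero_set f).

Definition nonzero_comps f : nat := n_comp (nonzero_edges f) (nonzero_set f).

Definition nonzero_loops f : int := cycle_rank (nonzero_set f) (nonzero_edges f).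

(* Isolated vertices do not contribute to the cycle rank, so all of [V] can be
   kept as the vertex set. *)
Definition sign_loops f : int :=
  cycle_rank [set: V] [rel u v | e u v && (0 < f u * f v)].

End Nodal.

(* Imported only here because classical_sets reuses the notations of finset. *)
From mathcomp Require Import all_classical all_reals all_analysis.
Import numFieldNormedType.Exports.

Section PLaplacian.
Context (R : realType) (V : finType) (e : rel V).
Context (omega : V -> V -> R) (rho kappa : V -> R) (p : R).
Implicit Types f : V -> R.

(* At [x = 0] this is 0 for every [p], whatever the value of [powR] at 0. *)
Definition phi (x : R) : R := `|x| `^ (p - 2) * x.

Definition plaplacian f (u : V) : R :=
  \sum_(v | e u v) omega u v * phi (f u - f v) + kappa u * phi (f u).

Definition eigenpair f (lam : R) : Prop :=
  (exists u, f u != 0) /\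
  (forall u, plaplacian f u = lam * rho u * phi (f u)).

(* The factor 1/2 compensates for each edge being summed over twice, once for
   each orientation. *)
Definition rayleigh f : R :=
  (2^-1 * (\sum_u \sum_(v | e u v) omega u v * `|f u - f v| `^ p)
   + \sum_u kappa u * `|f u| `^ p)
  / \sum_u rho u * `|f u| `^ p.

Definition pnorm f : R := (\sum_u `|f u| `^ p) `^ p^-1.

End PLaplacian.

Section Variational.
Local Open Scope classical_set_scope.
Context (R : realType) (V : finType).

(* [{ptws V -> R}] carries the product topology, which for the finite index
   type [V] is the usual topology of R^N. *)
Implicit Type A : set {ptws V -> R}.

Definition symmetric_set A : Prop := forall f, A f -> A (\- f).

Definition odd_map_avoiding0 A (k : nat) : Prop :=
  exists g : {ptws V -> R} -> 'rV[R]_k,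
    [/\ {within A, continuous g},
        forall f, A f -> g (\- f) = - g f
      & forall f, A f -> g f != 0].

(* The infimum is over a set of natural numbers, hence is its least element,
   and is +oo when that set is empty. *)
Definition genus A : \bar R :=
  ereal_inf [set (k%:R : R)%:E | k in odd_map_avoiding0 A].

Context (e : rel V) (omega : V -> V -> R) (rho kappa : V -> R) (p : R).

Definition genus_family (k : nat) : set (set {ptws V -> R}) :=
  [set A : set {ptws V -> R} | [/\ forall f, A f -> pnorm p f = 1,
               closed A,
               symmetric_set A
             & ((k%:R : R)%:E <= genus A)%E]].

(* Indices start at 1.  A nonempty closed subset of the sphere is compact, so
   each supremum is a maximum; for [1 <= k <= #|V|] the family is nonempty and
   the infimum is an attained real number.  Taking values in [\bar R] avoids
   building these facts into the definition. *)
Definition var_eigenvalue (k : nat) : \bar R :=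
  ereal_inf [set ereal_sup [set (rayleigh e omega rho kappa p f)%:E | f in A]
            | A in genus_family k].

Definition var_mult (lam : \bar R) : nat :=
  #|finset (fun i : 'I_#|V| => var_eigenvalue i.+1 == lam)|.

End Variational.

(* Main.v *)
Require Import Defs.
From HB Require Import structures.
From mathcomp Require Import all_boot all_order all_algebra.
From mathcomp Require Import all_classical all_reals all_analysis.
From mathcomp Require Import ring lra zify.

(** The cycle ranks and component counts in both bounds cancel.  Write [s] for
    the number of edges on which [f] changes sign, [z] for the number of zeros
    of [f] and [c] for the number of components of its support.  Since the graph
    of same-sign edges has at most [nu f + z] components, the first bound
    follows from [k <= s + z] and the second one from [k + m - 1 <= s + z + c]
    ([nodal_bound]).  The weaker form of the first bound then uses that deleting
    the [z] zeros from a connected graph removes at least [z] edges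
    ([deleted_edges]).

    Both inequalities come from a discrete Picone identity.  Let [g] vanish at
    the zeros of [f].  Testing the eigenvalue equation of [f] with
    [|g|^p / phi f] writes [lam] times the weighted mass of [g] as an edge sum
    similar to the energy of [g] ([picone_identity]).  Edge by edge, convexity
    of [|x|^p] bounds each term by the one of the energy when [f] has the same
    sign at both ends; when the signs differ, the two terms agree provided that
    [g] is proportional to [f] on the edge.  Hence the [s + z] linear
    conditions of vanishing at the zeros and of proportionality on the
    sign-changing edges imply that the Rayleigh quotient of [g] is at least
    [lam].  A set of genus at least [k] contains a point satisfying any
    [k - 1] odd conditions ([genus_common_zero]), so [lambda k < lam] forces
    [k <= s + z].

    For the second inequality, equality in Picone's bound makes [g]
    proportional to [f] on each component of the support, because convexity is
    strict.  Asking also that [g] vanish at one vertex per component, that is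
    [c] further conditions, leaves only Rayleigh quotients greater than [lam].
    By compactness of the sphere they exceed [lam] by a fixed amount
    ([rayleigh_gap]), so [lambda n <= lam] forces [n <= s + z + c]; this is
    applied to an index [n >= k + m - 1] with [lambda n = lambda k]
    ([mult_last_index]). *)

Set Implicit Arguments.
Unset Strict Implicit.
Unset Printing Implicit Defensive.

Import Order.TTheory GRing.Theory Num.Theory.
Import numFieldNormedType.Exports.

Local Open Scope ring_scope.

(** * Strict convexity of powers and the discrete Picone inequality *)

Section Picone.
Context (R : realType) (p : R).
Hypothesis p_gt1 : 1 < p.
Implicit Types a b s t x y m r : R.

Local Notation P x := (`|x : R| `^ p).

Let p_gt0 : 0 < p. Proof. by apply: lt_trans p_gt1. Qed.
Let p_neq0 : p != 0. Proof. by rewrite gt_eqF. Qed.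

Lemma ln_lt_subr1 x : 0 < x -> x != 1 -> ln x < x - 1.
Proof.
move=> x0 x1; have : ln x != 0 by rewrite ln_eq0.
by move/expR_gt1Dx; rewrite lnK ?posrE// ltrBrDl.
Qed.

Lemma ln_le_subr1 x : 0 < x -> ln x <= x - 1.
Proof.
move=> x0; have [->|x1] := eqVneq x 1; first by rewrite ln1 subrr.
exact/ltW/ln_lt_subr1.
Qed.

(** Two instances of [ln y <= y - 1], at [(1 + p * (r - 1)) / r] and, with
    weight [p - 1], at [1 / r]: the right-hand sides cancel. *)
Lemma strict_bernoulli r : r != 1 -> 1 + p * (r - 1) < P r.
Proof.
move=> r1; have [r0|r0] := leP r 0.
  apply: (@lt_le_trans _ _ 0); last exact: powR_ge0.
  by have := p_gt1; nra.
rewrite gtr0_norm//; set s := 1 + p * (r - 1).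
have [s0|s0] := leP s 0; first by apply: le_lt_trans s0 _; exact: powR_gt0.
rewrite -ltr_ln ?posrE ?powR_gt0// ln_powR.
have h1 : ln (s / r) <= s / r - 1 by apply: ln_le_subr1; rewrite divr_gt0.
have h2 : ln (r^-1) < r^-1 - 1.
  by apply: ln_lt_subr1; rewrite ?invr_gt0// invr_eq1.
rewrite ln_div ?posrE// in h1; rewrite lnV ?posrE// in h2.
have h3 : s / r - 1 + (p - 1) * (r^-1 - 1) = 0.
  by rewrite /s; field; rewrite gt_eqF.
have := p_gt1; nra.
Qed.

Lemma powR_norm_gt0 x : x != 0 -> 0 < P x.
Proof. by move=> x0; rewrite powR_gt0// normr_gt0. Qed.

Lemma powR_norm0 : P 0 = 0.
Proof. by rewrite normr0 powR0. Qed.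

Lemma powR_normM x y : P (x * y) = P x * P y.
Proof. by rewrite normrM powRM. Qed.

Lemma phi0 : phi p 0 = 0 :> R.
Proof. by rewrite /phi mulr0. Qed.

Lemma phiN x : phi p (- x) = - phi p x.
Proof. by rewrite /phi normrN mulrN. Qed.

Lemma phi_mulr x : phi p x * x = P x.
Proof.
have [->|x0] := eqVneq x 0; first by rewrite mulr0 powR_norm0.
rewrite /phi -mulrA -expr2 -real_normK ?num_real//.
rewrite -(powR_mulrn 2 (normr_ge0 x)) -powRD ?subrK//.
by rewrite normr_eq0 x0 implybT.
Qed.

Lemma phi_eq0 x : (phi p x == 0) = (x == 0).
Proof.
apply/idP/eqP => [/eqP px|->]; last by rewrite phi0.
apply/eqP; have := phi_mulr x; rewrite px mul0r => /esym/powR_eq0_eq0/eqP.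
by rewrite normr_eq0.
Qed.

Lemma phiM x y : phi p (x * y) = phi p x * phi p y.
Proof. by rewrite /phi normrM powRM// mulrACA. Qed.

Lemma phi_gt0 x : 0 < x -> 0 < phi p x.
Proof. by move=> x0; rewrite /phi mulr_gt0 ?powR_gt0 ?normr_gt0 ?gt_eqF. Qed.

(** The graph of [|x|^p] lies above its tangents: for nonzero [m] this is the
    Bernoulli inequality for the ratio [x / m]. *)
Lemma powR_norm_tangent m x :
  x != m -> P m + p * phi p m * (x - m) < P x.
Proof.
have [->|m0 xm] := eqVneq m 0.
  by move=> x0; rewrite phi0 powR_norm0 mulr0 mul0r addr0 powR_norm_gt0.
have /strict_bernoulli : x / m != 1.
  by apply: contra xm => /eqP xm; rewrite -(divfK m0 x) xm mul1r.
rewrite -(ltr_pM2l (powR_norm_gt0 m0)) -powR_normM (mulrC m) divfK//.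
apply: le_lt_trans; rewrite -phi_mulr le_eqVlt; apply/orP; left; apply/eqP.
by field.
Qed.

Lemma strict_convex_powR_norm s t x y : 0 < s -> 0 < t -> s + t = 1 ->
  x != y -> P (s * x + t * y) < s * P x + t * P y.
Proof.
move=> s0 t0 st xy; set m := s * x + t * y.
have sE : s = 1 - t by rewrite -st addrK.
have xm : x != m.
  have : t * (x - y) != 0 by rewrite mulf_neq0 ?subr_eq0// gt_eqF.
  apply: contra => /eqP xm; have : x - m = 0 by rewrite {1}xm subrr.
  by move=> <-; rewrite /m sE; apply/eqP; ring.
have ym : y != m.
  have : s * (x - y) != 0 by rewrite mulf_neq0 ?subr_eq0// gt_eqF.
  apply: contra => /eqP ym; have : m - y = 0 by rewrite {1}ym subrr.
  by move=> <-; rewrite /m sE; apply/eqP; ring.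
have h1 := powR_norm_tangent xm; have h2 := powR_norm_tangent ym.
have h3 : P m = s * (P m + p * phi p m * (x - m))
                + t * (P m + p * phi p m * (y - m)).
  rewrite {4 7}/m sE; ring.
rewrite {1}h3; apply: ltrD; by rewrite ltr_pM2l.
Qed.

(** The value on an edge, whose endpoints carry [a] and [b], of the test
    function [|g|^p / phi f]: here [x] and [y] are the values of [g]. *)
Definition picone_term a b x y : R :=
  phi p (a - b) * (P x / phi p a - P y / phi p b).

Lemma picone_termC a b x y : picone_term a b x y = picone_term b a y x.
Proof. by rewrite /picone_term -(opprB b a) phiN mulNr -mulrN opprB. Qed.

Lemma picone_termN a b x y : picone_term (- a) (- b) x y = picone_term a b x y.
Proof.
by rewrite /picone_term -opprD !phiN !invrN !mulrN -opprD mulrN mulNr opprK.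
Qed.

(** For [a > b > 0] and [t = b / a], the point [x] is the combination of
    [(x - y) / (1 - t)] and [y / t] with weights [1 - t] and [t]. *)
Let picone_lt a b x y : 0 < b < a -> x * b != y * a ->
  picone_term a b x y < P (x - y).
Proof.
move=> /andP[b0 ba] xbya; have a0 := lt_trans b0 ba.
have [an bn] : a != 0 /\ b != 0 by rewrite !gt_eqF.
set t := b / a; set s := (a - b) / a.
have t0 : 0 < t by rewrite divr_gt0.
have ab0 : 0 < a - b by rewrite subr_gt0.
have s0 : 0 < s by rewrite divr_gt0.
have st : s + t = 1 by rewrite /s /t; field.
have abn : a - b != 0 by rewrite gt_eqF.
have ne : (x - y) / s != y / t.
  apply: contra xbya; rewrite -subr_eq0 -[in X in _ -> X]subr_eq0 /s /t.
  rewrite (_ : _ - _ = (x * b - y * a) * (a / ((a - b) * b))); last first.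
    by field; rewrite an bn abn.
  by rewrite mulf_eq0 mulf_eq0 invr_eq0 !mulf_eq0 (negPf an) (negPf bn)
    (negPf abn) !orbF.
have := strict_convex_powR_norm s0 t0 st ne.
rewrite (_ : s * _ + _ = x); last by rewrite /s /t; field; rewrite an bn abn.
have PV z w : 0 < w -> w * P (z / w) = P z / phi p w.
  move=> w0; have wn : w != 0 by rewrite gt_eqF.
  rewrite powR_normM -[P w^-1]phi_mulr.
  have -> : phi p w^-1 = (phi p w)^-1.
    apply: (mulfI (x := phi p w)); rewrite ?phi_eq0// -phiM !divff ?phi_eq0//.
    by rewrite /phi normr1 powR1 mulr1.
  by field; rewrite phi_eq0 wn.
rewrite !PV//; have sn : phi p s != 0 by rewrite phi_eq0 gt_eqF.
rewrite -(ltr_pM2l (phi_gt0 s0)) mulrDr [phi p s * (P (x - y) / _)]mulrC.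
rewrite divfK// => h; rewrite -ltrBlDr in h; apply: le_lt_trans h.
rewrite /picone_term -{1}(divfK an (a - b)) -/s phiM.
have -> : phi p t = phi p b / phi p a.
  apply: (mulIf (x := phi p a)); rewrite ?phi_eq0// divfK ?phi_eq0//.
  by rewrite -phiM divfK.
rewrite le_eqVlt; apply/orP; left; apply/eqP; field.
by rewrite !phi_eq0 an bn.
Qed.

Let picone_pos a b x y : 0 < a -> 0 < b -> x * b != y * a ->
  picone_term a b x y < P (x - y).
Proof.
move=> a0 b0 ne; have [ab|ba|ab] := ltgtP a b.
- by rewrite picone_termC distrC picone_lt ?a0// eq_sym.
- by rewrite picone_lt ?b0.
- rewrite /picone_term ab subrr phi0 mul0r powR_norm_gt0// subr_eq0.
  by apply: contra ne => /eqP ->; rewrite ab.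
Qed.

Lemma picone_strict a b x y : 0 < a * b -> x * b != y * a ->
  picone_term a b x y < P (x - y).
Proof.
move=> ab ne; have [b0|b0|b0] := ltgtP b 0; last by rewrite b0 mulr0 ltxx in ab.
- have a0 : a < 0 by rewrite nmulr_lgt0 in ab.
  rewrite -picone_termN; apply: picone_pos; rewrite ?oppr_gt0//.
  by rewrite !mulrN eqr_opp.
- by apply: picone_pos => //; rewrite pmulr_lgt0 in ab.
Qed.

Lemma powR_norm_div_phi a : P a / phi p a = a.
Proof.
have [->|a0] := eqVneq a 0; first by rewrite powR_norm0 mul0r.
by rewrite -phi_mulr mulrAC divff ?mul1r// phi_eq0.
Qed.

(** This covers opposite signs, where the Picone inequality fails in general;
    proportionality restores it as an equality. *)
Lemma picone_proportional a b x y : a != 0 -> b != 0 -> x * b = y * a ->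
  picone_term a b x y = P (x - y).
Proof.
move=> a0 b0 xy; have [s [-> ->]] : exists s, x = s * a /\ y = s * b.
  by exists (x / a); rewrite divfK// mulrAC xy mulfK.
have sE z : P (s * z) / phi p z = P s * z.
  by rewrite powR_normM -mulrA powR_norm_div_phi.
rewrite /picone_term !sE -!mulrBr powR_normM -(phi_mulr (a - b)).
exact: mulrCA.
Qed.

Lemma picone_zero a x : picone_term a 0 x 0 = if a == 0 then 0 else P x.
Proof.
rewrite /picone_term phi0 invr0 mulr0 !subr0; case: eqVneq => [->|a0].
  by rewrite phi0 mul0r.
by rewrite mulrC divfK ?phi_eq0.
Qed.

Lemma continuous_powR_norm : continuous (fun x => P x).
Proof.
move=> x; have [->|x0] := eqVneq x 0.
  rewrite /continuous_at powR_norm0; apply/cvgrPdist_le => eps eps0.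
  near=> y; rewrite sub0r normrN ger0_norm ?powR_ge0//.
  have -> : eps = (eps `^ p^-1) `^ p.
    by rewrite -powRrM mulVf// powRr1// ltW.
  apply: ge0_ler_powR; rewrite ?nnegrE ?powR_ge0 ?(ltW p_gt0)//.
  rewrite -[y]subr0 -normrN opprB; near: y.
  by apply: cvgr_dist_le; [exact: cvg_id|exact: powR_gt0].
have hn : {for `|x : R|, continuous (fun y : R => y `^ p)}.
  apply: differentiable_continuous; apply/derivable1_diffP.
  by apply: derivable_powR; rewrite in_itv/= andbT normr_gt0.
by apply: (@continuous_comp _ _ _ (fun y : R => `|y|) (fun y : R => y `^ p));
  [exact: norm_continuous|exact: hn].
Unshelve. all: by end_near. Qed.

End Picone.

(** * Counting vertices, edges and components *)

Section Counting.
Context (R : realType) (V : finType) (e : rel V).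
Hypothesis e_sym : symmetric e.
Implicit Types (f : V -> R) (u v : V).

Definition same_sign_edges f : rel V := [rel u v | e u v && (0 < f u * f v)].

(** Each sign-changing edge, oriented from its positive to its negative end. *)
Definition sign_changes f : {set V * V} :=
  [set x | [&& e x.1 x.2, 0 < f x.1 & f x.2 < 0]].

Lemma mulr_gt0_const f u v (A : {set V}) :
  const_sign f A -> u \in A -> v \in A -> 0 < f u * f v.
Proof.
by case/orP => /forall_inP h uA vA; [rewrite mulr_gt0 ?h | rewrite nmulr_rgt0 ?h].
Qed.

Lemma connect_same_sign f u v :
  connect (same_sign_edges f) u v -> f u != 0 -> 0 < f u * f v.
Proof.
move=> /connectP[s]; elim: s u => [|w s IH] u /=; last first.
  move=> /andP[/andP[_ uw] sw] vE u0.
  have w0 : f w != 0 by apply: contraTneq uw => ->; rewrite mulr0 ltxx.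
  have wv := IH w sw vE w0.
  have := mulr_gt0 uw wv.
  rewrite mulrACA (mulrC (f w)) mulrACA.
  rewrite (_ : _ * _ * _ = f w ^+ 2 * (f u * f v)); last by ring.
  by rewrite pmulr_rgt0// exprn_even_gt0.
by move=> _ -> u0; rewrite -expr2 exprn_even_gt0.
Qed.

Lemma same_sign_edges_sym f : symmetric (same_sign_edges f).
Proof. by move=> u v; rewrite /same_sign_edges /= e_sym mulrC. Qed.

(** A connected vertex set of constant sign has only same-sign edges, so it
    cannot extend beyond the component of any of its vertices. *)
Lemma same_sign_component f u : f u != 0 ->
  [set v | connect (same_sign_edges f) u v] \in nodal_domains e f.
Proof.
move=> u0; set C := [set v | _]; have uC : u \in C by rewrite inE connect0.
have cs := sym_connect_sym (same_sign_edges_sym f).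
rewrite inE; apply/maxsetP; split.
  apply/andP; split; first (apply/andP; split).
  - by apply/set0Pn; exists u.
  - apply/forall_inP => v vC; apply/forall_inP => w wC.
    have : connect (same_sign_edges f) v w.
      move: vC wC; rewrite !inE => uv uw.
      by apply: connect_trans uw; rewrite cs.
    move=> /connectP[s]; elim: s v vC => [|x s IH] v vC /=.
      by move=> _ ->; exact: connect0.
    move=> /andP[vx xs] wE.
    have xC : x \in C.
      by move: vC; rewrite !inE => /connect_trans; apply; exact: connect1.
    apply: connect_trans (IH x xC xs wE); apply: connect1 => /=.
    by case/andP: vx => vx _; apply/and3P.
  - rewrite /const_sign; case: (ltgtP (f u) 0) u0 => // fu _; apply/orP.
    + right; apply/forall_inP => v; rewrite inE => /connect_same_sign.
      by rewrite lt_eqF// => /(_ isT); rewrite nmulr_rgt0.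
    + left; apply/forall_inP => v; rewrite inE => /connect_same_sign.
      by rewrite gt_eqF// => /(_ isT); rewrite pmulr_rgt0.
move=> B /andP[/andP[_ /forall_inP cB] sB] CB; apply/eqP.
rewrite finset.eqEsubset CB andbT; apply/fintype.subsetP => v vB; rewrite inE.
have uB := fintype.subsetP CB _ uC.
move: (forall_inP (cB u uB) v vB); apply: connect_sub => x y /=.
move=> /and3P[xy xB yB]; apply/connect1/andP; split=> //.
exact: mulr_gt0_const sB xB yB.
Qed.

(** A component of the graph of same-sign edges is either an isolated zero
    vertex or a nodal domain. *)
Lemma same_sign_comps_le f :
  (n_comp (same_sign_edges f) [set: V] <= nodal_count e f + zero_count f)%N.
Proof.
have cs := sym_connect_sym (same_sign_edges_sym f).
set A := [set u | roots (same_sign_edges f) u & f u != 0].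
apply: (@leq_trans (#|A| + zero_count f)).
  apply: leq_trans (leq_card_setU _ _); apply: subset_leq_card.
  by apply/fintype.subsetP => u; rewrite !inE => /andP[-> _]; rewrite orNb.
rewrite leq_add2r.
pose C u := [set v | connect (same_sign_edges f) u v].
rewrite -(card_in_imset (f := C) (D := mem A)).
  apply: subset_leq_card; apply/fintype.subsetP => _ /imsetP[u uA ->].
  by apply: same_sign_component; move: uA; rewrite !inE => /andP[].
move=> u v; rewrite !inE => /andP[/eqP ru _] /andP[/eqP rv _] CE.
rewrite -ru -rv; apply/(fingraph.rootP cs).
have : v \in C u by rewrite CE inE connect0.
by rewrite inE.
Qed.

(** An edge of the support either joins values of the same sign or is a sign
    change, with a unique orientation. *)
Lemma edge_count_split f :
  (edge_count (same_sign_edges f) + #|sign_changes f|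
     <= edge_count (nonzero_edges e f))%N.
Proof.
pose E x : {set V} := [set x.1; x.2].
have Einj : {in sign_changes f &, injective E}.
  move=> [u v] [u' v']; rewrite !inE /= => /and3P[_ u0 v0] /and3P[_ u0' v0'] EE.
  have /orP[/eqP uu|/eqP uv] : (u == u') || (u == v').
    by rewrite -in_set2 -[[set u'; v']]EE !inE eqxx.
  - have /orP[/eqP vu|/eqP vv] : (v == u') || (v == v').
      by rewrite -in_set2 -[[set u'; v']]EE !inE eqxx orbT.
    + by move: v0; rewrite vu ltNge ltW.
    + by rewrite uu vv.
  - by move: u0; rewrite uv ltNge ltW.
rewrite -(card_in_imset Einj).
rewrite /edge_count -cardsUI [X in (_ + X)%N](_ : _ = 0%N) ?addn0; last first.
  apply/eqP; rewrite cards_eq0 -finset.subset0; apply/fintype.subsetP => A.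
  rewrite !inE => /andP[/imsetP[[u v]] + ->] /imsetP[[u' v']].
  rewrite !inE /= => /andP[_ uv] /and3P[_ u0' v0'] /setP EE.
  have:= EE u'; have := EE v'; rewrite /E !inE !eqxx !orbT /=.
  move=> /orP[]/eqP vE /orP[]/eqP uE; subst => //.
  - by move: v0'; rewrite ltNge ltW.
  - by move: uv; rewrite pmulr_lgt0// ltNge ltW.
  - by move: uv; rewrite pmulr_rgt0// ltNge ltW.
  - by move: v0'; rewrite ltNge ltW.
apply: subset_leq_card; apply/fintype.subsetP => A; rewrite inE.
move=> /orP[]/imsetP[[u v]]; rewrite !inE /=.
  move=> /andP[uv s] ->; apply/imsetP; exists (u, v) => //; rewrite inE /=.
  apply/and3P; split => //; rewrite inE; move: s; apply: contraTneq => ->.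
    by rewrite mul0r ltxx.
  by rewrite mulr0 ltxx.
move=> /and3P[uv u0 v0] ->; apply/imsetP; exists (u, v) => //; rewrite inE /=.
by apply/and3P; split => //; rewrite inE; [rewrite gt_eqF|rewrite lt_eqF].
Qed.

Lemma card_nonzero f : (#|nonzero_set f| + zero_count f = #|V|)%N.
Proof.
rewrite addnC -(cardsC [set u | f u == 0]); congr (_ + #|pred_of_set _|)%N.
by apply/setP => u; rewrite !inE.
Qed.

(** The cycle ranks and component counts cancel, leaving the number of
    conditions which the Picone argument imposes on a test function. *)
Lemma nodal_bound f (n : int) :
  n <= (#|sign_changes f| + zero_count f)%:Z ->
  n - nonzero_loops e f + sign_loops e f - (zero_count f)%:Z
    + (nonzero_comps e f)%:Z <= (nodal_count e f)%:Z.
Proof.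
rewrite /nonzero_loops /sign_loops /cycle_rank cardsT -/(same_sign_edges f).
rewrite -/(nonzero_edges e f) -/(nonzero_comps e f).
have := card_nonzero f; have := edge_count_split f.
have := same_sign_comps_le f; rewrite /nonzero_comps.
set a := n_comp _ _; set b := n_comp _ _; lia.
Qed.

(** Every zero vertex owns an edge, leading to a neighbour that is closer to the
    support of [f].  Since an owner is the farther end of its edge, no edge has
    two owners. *)
Lemma deleted_edges f : connected_graph e -> (exists u, f u != 0) ->
  (edge_count (nonzero_edges e f) + zero_count f <= edge_count e)%N.
Proof.
move=> conn [u0 fu0].
pose near u n := [exists v, (f v != 0) && [exists s : n.-tuple V,
  path e u s && (last u s == v)]].
have nearP u : exists n, near u n.
  have /connectP[s us sE] := conn u u0; exists (size s); apply/existsP; exists u0.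
  rewrite fu0; apply/existsP; exists (in_tuple s); rewrite us /=.
  by rewrite sE eqxx.
pose d u := ex_minn (nearP u).
have closer u : f u = 0 -> exists w, e u w && (d w < d u)%N.
  move=> fu; rewrite /d; case: (ex_minnP (nearP u)) => n.
  move=> /existsP[v /andP[fv /existsP[s /andP[us /eqP sv]]]] _.
  case: n s us sv => [|n] s us sv.
    by move: sv fv; rewrite (tuple0 s) /= => <-; rewrite fu eqxx.
  case/tupleP: s us sv => w s /= /andP[uw ws] sv; exists w; rewrite uw /=.
  case: ex_minnP => k _; apply; apply/existsP; exists v; rewrite fv.
  by apply/existsP; exists s; rewrite ws /= sv eqxx.
pose par u := odflt u [pick w | e u w && (d w < d u)%N].
have parP u : f u = 0 -> e u (par u) && (d (par u) < d u)%N.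
  move=> fu; rewrite /par; case: pickP => //= none.
  by have [w] := closer u fu; rewrite none.
pose E u : {set V} := [set u; par u].
have Einj : {in [set u | f u == 0] &, injective E}.
  move=> u v; rewrite !inE => /eqP/parP/andP[_ du] /eqP/parP/andP[_ dv] EE.
  have : u \in E v by rewrite -EE !inE eqxx.
  rewrite !inE => /orP[/eqP//|/eqP uE].
  have : v \in E u by rewrite EE !inE eqxx.
  rewrite !inE => /orP[/eqP//|/eqP vE].
  by move: du dv; rewrite -vE -uE => du; rewrite ltnNge ltnW.
rewrite /zero_count -(card_in_imset Einj) /edge_count -cardsUI.
rewrite [X in (_ + X)%N](_ : _ = 0%N) ?addn0; last first.
  apply/eqP; rewrite cards_eq0 -finset.subset0; apply/fintype.subsetP => A.
  rewrite !inE => /andP[/imsetP[[v w]] + ->] /imsetP[u].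
  rewrite !inE /= => /and3P[_ v0 w0] fu /setP/(_ u); rewrite !inE eqxx /=.
  move=> uE; have : u \in nonzero_set f by case/orP: uE => /eqP ->.
  by rewrite inE fu.
apply: subset_leq_card; apply/fintype.subsetP => A; rewrite inE.
move=> /orP[/imsetP[[v w]]|/imsetP[u]]; rewrite !inE /=.
  by move=> /and3P[vw _ _] ->; apply/imsetP; exists (v, w); rewrite ?inE.
move=> /eqP/parP/andP[uw _] ->.
by apply/imsetP; exists (u, par u); rewrite ?inE.
Qed.

Lemma loops_le_beta f : connected_graph e -> (exists u, f u != 0) ->
  nonzero_loops e f - (nonzero_comps e f)%:Z < (edge_count e)%:Z - #|V|%:Z + 1.
Proof.
move=> conn fn; have := deleted_edges conn fn; have := card_nonzero f.
rewrite /nonzero_loops /cycle_rank -/(nonzero_comps e f) /nonzero_comps.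
set a := n_comp _ _; lia.
Qed.

End Counting.

(** * The Picone identity summed over the graph *)

Section RayleighBound.
Context (R : realType) (V : finType) (e : rel V).
Context (omega : V -> V -> R) (rho kappa : V -> R) (p : R).
Hypothesis (e_sym : symmetric e).
Hypothesis (omega_sym : forall u v, e u v -> omega u v = omega v u).
Hypothesis (omega_gt0 : forall u v, e u v -> 0 < omega u v).
Hypothesis (rho_gt0 : forall u, 0 < rho u).
Hypothesis p_gt1 : 1 < p.
Implicit Types (f g : V -> R) (u v : V) (lam : R).

Definition energy g : R :=
  2^-1 * (\sum_u \sum_(v | e u v) omega u v * `|g u - g v| `^ p)
  + \sum_u kappa u * `|g u| `^ p.

Definition weighted_mass g : R := \sum_u rho u * `|g u| `^ p.

(** The linear conditions under which the Picone inequality for the pair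
    [f], [g] holds on every edge. *)
Definition picone_admissible f g : Prop :=
  (forall u, f u = 0 -> g u = 0) /\
  (forall u v, (u, v) \in sign_changes e f -> g u * f v = g v * f u).

Lemma admissible_opposite f g u v : picone_admissible f g ->
  e u v -> f u * f v < 0 -> g u * f v = g v * f u.
Proof.
move=> [_ gP] uv; have [fu|fu|->] := ltgtP (f u) 0; last by rewrite mul0r ltxx.
  rewrite nmulr_rlt0// => fv; apply/esym/gP.
  by rewrite inE /= e_sym uv fu fv.
by rewrite pmulr_rlt0// => fv; apply: gP; rewrite inE /= uv fu fv.
Qed.

Lemma admissible_edge f g u v : picone_admissible f g -> e u v ->
  picone_term p (f u) (f v) (g u) (g v) <= `|g u - g v| `^ p ?= iff
    [|| f u == 0, f v == 0 | g u * f v == g v * f u].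
Proof.
move=> adm uv; have [fu0|fu0] := eqVneq (f u) 0.
  rewrite /= fu0 (adm.1 u fu0) picone_termC picone_zero// sub0r normrN.
  case: eqVneq => [fv0|_]; last exact/leif_refl.
  by rewrite (adm.1 v fv0) powR_norm0//; exact/leif_refl.
have [fv0|fv0] := eqVneq (f v) 0.
  by rewrite /= fv0 (adm.1 v fv0) picone_zero// (negPf fu0) subr0; exact/leif_refl.
have [E|ne] /= := eqVneq (g u * f v) (g v * f u).
  by rewrite picone_proportional//; exact/leif_refl.
have uv_gt0 : 0 < f u * f v.
  rewrite lt_neqAle eq_sym mulf_neq0//= leNgt; apply: contra ne => fuv.
  by rewrite (admissible_opposite adm).
by apply/leifP; exact: picone_strict.
Qed.

(** Testing the eigenvalue equation with [|g|^p / phi f] and symmetrizing the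
    sum over oriented edges. *)
Lemma picone_identity f g lam : eigenpair e omega rho kappa p f lam ->
  (forall u, f u = 0 -> g u = 0) ->
  lam * weighted_mass g =
  2^-1 * (\sum_u \sum_(v | e u v)
            omega u v * picone_term p (f u) (f v) (g u) (g v))
  + \sum_u kappa u * `|g u| `^ p.
Proof.
move=> [_ eig] gz; pose h u := `|g u| `^ p / phi p (f u).
have hE u : phi p (f u) * h u = `|g u| `^ p.
  rewrite /h; have [fu0|fu0] := eqVneq (f u) 0.
    by rewrite fu0 phi0 mul0r (gz u fu0) powR_norm0.
  by rewrite mulrC divfK ?phi_eq0.
have -> : lam * weighted_mass g = \sum_u plaplacian e omega kappa p f u * h u.
  rewrite /weighted_mass mulr_sumr; apply: eq_bigr => u _.
  by rewrite eig -mulrA hE mulrA.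
under eq_bigr do rewrite /plaplacian mulrDl -mulrA hE.
rewrite big_split /=; congr (_ + _).
pose F u v := omega u v * phi p (f u - f v) * h u.
have swap : \sum_u \sum_(v | e u v) F u v
          = \sum_u \sum_(v | e u v) - (omega u v * phi p (f u - f v) * h v).
  rewrite (exchange_big_dep xpredT)//=; apply: eq_bigr => u _.
  rewrite (eq_bigl (e u)) => [|v]; last by rewrite e_sym.
  apply: eq_bigr => v uv.
  by rewrite /F -(omega_sym uv) -(opprB (f u)) phiN mulrN mulNr.
have -> : \sum_u (\sum_(v | e u v) omega u v * phi p (f u - f v)) * h u
        = \sum_u \sum_(v | e u v) F u v.
  by apply: eq_bigr => u _; rewrite mulr_suml.
apply: (mulfI (x := 2)); first by rewrite pnatr_eq0.
rewrite mulrA divff ?pnatr_eq0// mul1r mulr_natl mulr2n {2}swap -big_split.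
apply: eq_bigr => u _; rewrite -big_split; apply: eq_bigr => v _ /=.
by rewrite /F /picone_term -/(h u) -/(h v) -mulrBr mulrA.
Qed.

Lemma weighted_mass_gt0 g : (exists u, g u != 0) -> 0 < weighted_mass g.
Proof.
move=> [u gu]; rewrite /weighted_mass (bigD1 u)//= ltr_pwDl//.
  by rewrite mulr_gt0 ?powR_gt0 ?normr_gt0.
by apply: sumr_ge0 => v _; rewrite mulr_ge0 ?powR_ge0 ?ltW.
Qed.

Lemma eigenvalue_mass_le_energy f g lam :
  eigenpair e omega rho kappa p f lam -> picone_admissible f g ->
  lam * weighted_mass g <= energy g.
Proof.
move=> eig adm; rewrite (picone_identity eig adm.1) lerD2r ler_pM2l ?invr_gt0//.
apply: ler_sum => u _; apply: ler_sum => v uv; rewrite ler_pM2l ?omega_gt0//.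
by rewrite (admissible_edge adm uv).
Qed.

(** Equality on all edges makes [g / f] constant on every component of the
    support of [f]; there it vanishes at the component's representative. *)
Lemma eigenvalue_mass_lt_energy f g lam :
  eigenpair e omega rho kappa p f lam -> picone_admissible f g ->
  (forall u, u \in predI (roots (nonzero_edges e f)) [in nonzero_set f] ->
     g u = 0) ->
  (exists u, g u != 0) ->
  lam * weighted_mass g < energy g.
Proof.
move=> eig adm groot [w gw]; rewrite lt_neqAle (eigenvalue_mass_le_energy eig adm) andbT.
apply: contra gw; rewrite (picone_identity eig adm.1) (inj_eq (addIr _)).
rewrite (inj_eq (mulfI _)) ?invr_eq0 ?pnatr_eq0// => /eqP sumE.
have le u v : e u v -> 0 <= omega u v * (`|g u - g v| `^ p
    - picone_term p (f u) (f v) (g u) (g v)).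
  move=> uv; apply: mulr_ge0; first exact/ltW/omega_gt0.
  by rewrite subr_ge0 (admissible_edge adm uv).
have sum0 : \sum_u \sum_(v | e u v) omega u v * (`|g u - g v| `^ p
    - picone_term p (f u) (f v) (g u) (g v)) = 0.
  apply/eqP; under eq_bigr do (under eq_bigr do rewrite mulrBr; rewrite sumrB).
  by rewrite sumrB subr_eq0 sumE.
have edgeE u v : e u v -> f u != 0 -> f v != 0 -> g u * f v = g v * f u.
  move=> uv fu fv.
  have ge0 u' : xpredT u' -> 0 <= \sum_(v' | e u' v') omega u' v' *
    (`|g u' - g v'| `^ p - picone_term p (f u') (f v') (g u') (g v')).
    by move=> _; apply: sumr_ge0 => v'; exact: le.
  move: sum0 => /(psumr_eq0P ge0)/(_ u isT)/(psumr_eq0P (le u))/(_ v uv)/eqP.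
  rewrite mulf_eq0 gt_eqF ?omega_gt0//= subr_eq0 eq_sym.
  by rewrite (admissible_edge adm uv) (negPf fu) (negPf fv) => /eqP.
apply/eqP; have [fw|fw] := eqVneq (f w) 0; first exact: adm.1.
set r := fingraph.root (nonzero_edges e f) w.
have : connect (nonzero_edges e f) w r by exact: connect_root.
have propor u v : connect (nonzero_edges e f) u v -> f u != 0 ->
    f v != 0 /\ g u * f v = g v * f u.
  move=> /connectP[s]; elim: s u => [|x s IH] u /=; first by move=> _ -> fu.
  move=> /andP[ux xs] vE fu; move: ux => /and3P[ux _]; rewrite inE => fx.
  have [fv E] := IH x xs vE fx; split => //.
  apply: (mulfI fx).
  transitivity (f v * (g u * f x)); first by ring.
  rewrite (edgeE u x ux fu fx); transitivity (f u * (g x * f v)); first by ring.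
  by rewrite E; ring.
move=> wr; have [fr] := propor _ _ wr fw.
have nsym : connect_sym (nonzero_edges e f).
  have flip u v : e u v -> e v u by rewrite e_sym.
  apply: sym_connect_sym => u v.
  by apply/idP/idP => /and3P[/flip vu uf vf]; apply/and3P.
rewrite (groot r) ?mul0r; last by rewrite inE /= roots_root// inE.
by move=> /eqP; rewrite mulf_eq0 (negPf fr) orbF => /eqP.
Qed.

End RayleighBound.

(** * Genus and variational eigenvalues *)

Section Genus.
Context (R : realType) (V : finType).
Local Open Scope classical_set_scope.
Implicit Types (A : set {ptws V -> R}) (g : {ptws V -> R}).

Lemma ptws_eval_continuous (u : V) : continuous (fun g : {ptws V -> R} => g u).
Proof. exact: (@proj_continuous _ (fun _ : V => R) u). Qed.

Lemma continuous_row (T : topologicalType) (n : nat) (G : 'I_n -> T -> R) :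
  (forall i, continuous (G i)) ->
  continuous (fun x => \row_i G i x : 'rV[R]_n).
Proof.
move=> cG x B [P Pn PB].
have : \forall y \near x, forall i j, P i j ((\row_j G j y : 'rV[R]_n) i j).
  apply: filter_forall => i; apply: filter_forall => j.
  have cGj : {for x, continuous (fun y => (\row_j G j y : 'rV[R]_n) i j)}.
    rewrite (_ : (fun y => _) = G j); first exact: cG.
    by apply/funext => y; rewrite mxE.
  exact: cGj (Pn i j).
by apply: filterS => y yP; exact: PB.
Qed.

(** Without a common zero, the functions [L i] would be the coordinates of an
    odd map on [A] that avoids the origin of a space of dimension [#|I|]. *)
Lemma genus_common_zero A (k : nat) (I : finType) (L : I -> {ptws V -> R} -> R) :
  (k%:R%:E <= genus A)%E ->
  (forall i, continuous (L i)) -> (forall i g, L i (\- g) = - L i g) ->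
  (#|I| < k)%N -> exists2 g, A g & forall i, L i g = 0.
Proof.
move=> kA Lc Lodd Ik; apply: contrapT => none; move: Ik; apply/negP.
rewrite -leqNgt -(ler_nat R) -lee_fin; apply: le_trans kA _.
apply: ereal_inf_lbound; exists #|I| => //.
exists (fun g => \row_(i < #|I|) L (enum_val i) g); split.
- by apply: continuous_subspaceT; apply: continuous_row => i; exact: Lc.
- by move=> g _; apply/rowP => i; rewrite !mxE Lodd.
- move=> g Ag; apply/eqP => /rowP Lg; apply: none; exists g => // i.
  by have := Lg (enum_rank i); rewrite !mxE enum_rankK.
Qed.

Lemma continuous_powR_eval (p : R) (u : V) : 1 < p ->
  continuous (fun g : {ptws V -> R} => `|g u| `^ p).
Proof.
move=> p1 g; apply: (@continuous_comp _ _ _ (fun g : {ptws V -> R} => g u)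
  (fun x : R => `|x| `^ p)); first exact: ptws_eval_continuous.
exact: continuous_powR_norm.
Qed.

(** The sphere is a closed subset of the cube [[-1, 1]^V], which is compact by
    Tychonoff's theorem. *)
Lemma unit_sphere_compact (p : R) : 1 < p ->
  compact [set g : {ptws V -> R} | \sum_u `|g u| `^ p = 1].
Proof.
move=> p1; have p0 : 0 < p by apply: lt_trans p1.
apply: (@subclosed_compact _ _ [set g : {ptws V -> R} | forall u, `[-1, 1] (g u)]).
- apply: (@closed_comp _ _ (fun g : {ptws V -> R} => \sum_u `|g u| `^ p) [set 1]);
    last exact: closed_eq.
  move=> g _; apply: continuous_big; first exact: add_continuous.
  by move=> u _; exact: continuous_powR_eval.
- apply: (@tychonoff V (fun _ => R) (fun _ => `[-1, 1])) => u.
  exact: segment_compact.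
- move=> g /= g1 u; rewrite /= in_itv/= -ler_norml.
  rewrite leNgt; apply/negP => gu; suff : 1 < \sum_u `|g u| `^ p by rewrite g1 ltxx.
  rewrite (bigD1 u)//= ltr_wpDr ?sumr_ge0//.
  by have := gt0_ltr_powR p0 _ _ gu; rewrite powR1; apply; rewrite nnegrE.
Qed.

End Genus.

Section Minimax.
Context (R : realType) (V : finType) (e : rel V).
Context (omega : V -> V -> R) (rho kappa : V -> R) (p : R).
Hypothesis (e_sym : symmetric e).
Hypothesis (omega_sym : forall u v, e u v -> omega u v = omega v u).
Hypothesis (omega_gt0 : forall u v, e u v -> 0 < omega u v).
Hypothesis (rho_gt0 : forall u, 0 < rho u).
Hypothesis p_gt1 : 1 < p.
Local Open Scope classical_set_scope.
Implicit Types (g : {ptws V -> R}) (u v : V) (lam mu : R).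

Local Notation lambda := (var_eigenvalue e omega rho kappa p).
Local Notation ray := (rayleigh e omega rho kappa p).
Local Notation mass g := (weighted_mass rho p g).
Local Notation en g := (energy e omega kappa p g).

Lemma pnorm_eq1 (g : V -> R) : pnorm p g = 1 -> \sum_u `|g u| `^ p = 1.
Proof.
move=> /eqP; rewrite /pnorm powR_eq1 invr_eq0 [p == 0]gt_eqF ?orbF; last first.
  exact: lt_trans p_gt1.
by case/orP=> [/eqP//|]; rewrite ltNge sumr_ge0// => u _; exact: powR_ge0.
Qed.

Lemma unit_sphere_neq0 g : \sum_u `|g u| `^ p = 1 -> exists u, g u != 0.
Proof.
move=> g1; apply/existsP; apply: contraPT g1 => /existsPn g0.
rewrite big1 => [/eqP|u _]; first by rewrite eq_sym oner_eq0.
have /negPn/eqP -> := g0 u; rewrite powR_norm0//.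
Qed.

(** Every set competing for [lambda k] meets the locus of fewer than [k] odd
    constraints, so a lower bound for the Rayleigh quotient on that locus
    bounds all the suprema in the definition of [lambda k]. *)
Lemma var_eigenvalue_ge (k : nat) (I : finType) (L : I -> {ptws V -> R} -> R) mu :
  (forall i, continuous (L i)) -> (forall i g, L i (\- g) = - L i g) ->
  (#|I| < k)%N ->
  (forall g, \sum_u `|g u| `^ p = 1 -> (forall i, L i g = 0) -> mu <= ray g) ->
  (mu%:E <= lambda k)%E.
Proof.
move=> Lc Lodd Ik mu_le; apply: le_ereal_inf_tmp => _ [A [A1 _ _ kA] <-].
have [g Ag Lg] := genus_common_zero kA Lc Lodd Ik.
apply: (@le_trans _ _ (ray g)%:E).
  by rewrite lee_fin; apply: mu_le => //; apply: pnorm_eq1; exact: A1.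
by apply: ereal_sup_ubound; exists g.
Qed.

Lemma var_eigenvalue_mono (j k : nat) : (j <= k)%N -> (lambda j <= lambda k)%E.
Proof.
move=> jk; apply: ereal_inf_le_tmp => _ [A [A1 Ac As kA] <-].
exists A => //; split => //; apply: le_trans kA.
by rewrite lee_fin ler_nat.
Qed.

Let continuous_sum (I : finType) (P : pred I) (F : I -> {ptws V -> R} -> R) :
  (forall i, P i -> continuous (F i)) ->
  continuous (fun g => \sum_(i | P i) F i g).
Proof. by move=> cF; apply: continuous_big => //; exact: add_continuous. Qed.

Let continuous_scale (c : R) (F : {ptws V -> R} -> R) :
  continuous F -> continuous (fun g => c * F g).
Proof. by move=> cF g; exact: (continuousM (cvg_cst c) (cF g)). Qed.

Let continuous_add (F G : {ptws V -> R} -> R) :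
  continuous F -> continuous G -> continuous (fun g => F g + G g).
Proof. by move=> cF cG g; exact: (continuousD (cF g) (cG g)). Qed.

Let continuous_sub (F G : {ptws V -> R} -> R) :
  continuous F -> continuous G -> continuous (fun g => F g - G g).
Proof. by move=> cF cG g; exact: (continuousB (cF g) (cG g)). Qed.

Lemma continuous_energy : continuous (fun g => en g).
Proof.
apply: continuous_add.
  apply: continuous_scale; apply: continuous_sum => u _.
  apply: continuous_sum => v _; apply: continuous_scale => g.
  apply: (@continuous_comp _ _ _ (fun g : {ptws V -> R} => g u - g v)
    (fun x : R => `|x| `^ p)); last exact: continuous_powR_norm.
  by apply: continuous_sub => {}g; exact: ptws_eval_continuous.
apply: continuous_sum => u _; apply: continuous_scale.
exact: continuous_powR_eval.
Qed.

Lemma continuous_mass : continuous (fun g => mass g).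
Proof.
apply: continuous_sum => u _; apply: continuous_scale.
exact: continuous_powR_eval.
Qed.

Lemma mass_le g : \sum_u `|g u| `^ p = 1 -> mass g <= \sum_u rho u.
Proof.
move=> g1; apply: ler_sum => u _; rewrite ger_pMr// -g1 (bigD1 u)//= lerDl.
by apply: sumr_ge0 => v _; exact: powR_ge0.
Qed.

(** A strict lower bound for the Rayleigh quotient on the part of the sphere
    cut out by closed conditions is uniform, by compactness. *)
Lemma rayleigh_gap (I : finType) (L : I -> {ptws V -> R} -> R) lam :
  (forall i, continuous (L i)) ->
  (forall g, \sum_u `|g u| `^ p = 1 -> (forall i, L i g = 0) ->
     lam * mass g < en g) ->
  exists2 eps, 0 < eps & forall g, \sum_u `|g u| `^ p = 1 ->
     (forall i, L i g = 0) -> lam + eps <= ray g.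
Proof.
move=> Lc pos; pose K := [set g : {ptws V -> R} | \sum_u `|g u| `^ p = 1] `&`
  \bigcap_(i in [set: I]) (L i @^-1` [set 0]).
have KP g : \sum_u `|g u| `^ p = 1 -> (forall i, L i g = 0) -> K g.
  by move=> g1 gL; split => // i _; exact: gL.
have [K0|/nonemptyPn K0] := pselect (K !=set0); last first.
  (* The constraints leave no point of the sphere: any [eps] will do. *)
  by exists 1 => // g g1 /(KP g g1); rewrite K0.
have cK : compact K.
  apply: compact_closedI; first exact: unit_sphere_compact.
  apply: closed_bigI => i _; apply: closed_comp; last exact: closed_eq.
  by move=> g _; exact: Lc.
pose N g := en g - lam * mass g.
have cN : {within K, continuous N}.
  apply: continuous_subspaceT; apply: continuous_sub.
    exact: continuous_energy.
  by apply: continuous_scale; exact: continuous_mass.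
have [c + cmin] := compact_EVT_min K0 cK cN.
rewrite inE => -[c1 cL].
have Nc : 0 < N c by rewrite subr_gt0 pos// => i; exact: cL.
have rho0 : 0 <= \sum_u rho u by apply: sumr_ge0 => u _; exact: ltW.
have den : 0 < 1 + \sum_u rho u by apply: ltr_pwDl.
(* On the sphere the mass is at most the sum of the [rho u]; the added 1 keeps
   the denominator positive when [V] is empty. *)
exists (N c / (1 + \sum_u rho u)); first by rewrite divr_gt0.
move=> g g1 gL; have m0 : 0 < mass g.
  by apply: weighted_mass_gt0 => //; exact: unit_sphere_neq0.
have Nle : N c <= N g by apply: cmin; rewrite inE; exact: KP.
rewrite /rayleigh -/(energy e omega kappa p g) -/(weighted_mass rho p g).
rewrite ler_pdivlMr// mulrDl -lerBrDl; apply: le_trans Nle.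
rewrite -mulrA ger_pMr// mulrC ler_pdivrMr// mul1r.
by apply: le_trans (mass_le g1) _; rewrite lerDr.
Qed.

Section Constraints.
Variables (f : V -> R) (B : {set V}).

Definition constraint_index : finType :=
  ({x | x \in sign_changes e f} + {u | u \in B})%type.

(** With [B] the zero set of [f] these conditions amount to
    [picone_admissible]; a larger [B] also fixes one vertex in each component
    of the support. *)
Definition constraint (i : constraint_index) g : R :=
  match i with
  | inl x => f (val x).2 * g (val x).1 - f (val x).1 * g (val x).2
  | inr u => g (val u)
  end.

Lemma constraint_continuous i : continuous (constraint i).
Proof.
case: i => [x|u]; last exact: ptws_eval_continuous.
by apply: continuous_sub; apply: continuous_scale; exact: ptws_eval_continuous.
Qed.

Lemma constraintN i g : constraint i (\- g) = - constraint i g.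
Proof. by case: i => [x|u] //=; rewrite !mulrN opprB opprK addrC. Qed.

Lemma card_constraint_index : #|constraint_index| = (#|sign_changes e f| + #|B|)%N.
Proof. by rewrite card_sum !card_sig. Qed.

Lemma constraint_admissible g : (forall u, f u = 0 -> u \in B) ->
  (forall i, constraint i g = 0) ->
  picone_admissible e f g /\ (forall u, u \in B -> g u = 0).
Proof.
move=> fB gL; have gB u : u \in B -> g u = 0.
  by move=> uB; exact: (gL (inr (exist _ u uB))).
split=> //; split=> [u /fB/gB//|u v uv].
apply/eqP; rewrite -subr_eq0 mulrC [X in _ - X]mulrC; apply/eqP.
exact: (gL (inl (exist _ (u, v) uv))).
Qed.

End Constraints.

(** Otherwise the constraints that make the Picone inequality valid would be
    fewer than [k], and [lam] would be a lower bound for [lambda k]. *)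
Lemma lt_eigenvalue_index_le (f : V -> R) lam (k : nat) :
  eigenpair e omega rho kappa p f lam -> (lambda k < lam%:E)%E ->
  (k <= #|sign_changes e f| + zero_count f)%N.
Proof.
move=> eig; rewrite ltNge; apply: contraNleq.
rewrite -card_constraint_index => Ik; apply: var_eigenvalue_ge Ik _.
- exact: constraint_continuous.
- exact: constraintN.
move=> g g1 /constraint_admissible[|adm _]; first by move=> u fu; rewrite inE fu.
rewrite /rayleigh -/(energy e omega kappa p g) -/(weighted_mass rho p g).
rewrite ler_pdivlMr; last by apply: weighted_mass_gt0 => //; exact: unit_sphere_neq0.
exact: eigenvalue_mass_le_energy eig adm.
Qed.

(** One more constraint per component of the support makes the Picone
    inequality strict.  The compactness gap then replaces the existence of a
    minimizing set in the definition of [lambda n]. *)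
Lemma le_eigenvalue_index_le (f : V -> R) lam (n : nat) :
  eigenpair e omega rho kappa p f lam -> (lambda n <= lam%:E)%E ->
  (n <= #|sign_changes e f| + zero_count f + nonzero_comps e f)%N.
Proof.
move=> eig; rewrite leNgt; apply: contraNleq => In.
pose B := finset (fun u => f u == 0) :|:
  finset (fun u => u \in predI (roots (nonzero_edges e f)) [in nonzero_set f]).
have fB u : f u = 0 -> u \in B by move=> fu; rewrite finset.in_setU inE fu eqxx.
have [|eps eps0 gap] :=
    @rayleigh_gap _ (@constraint f B) lam (@constraint_continuous f B).
  move=> g g1 /(constraint_admissible fB)[adm gB].
  apply: eigenvalue_mass_lt_energy eig adm _ (unit_sphere_neq0 g1) => // u uB.
  by apply: gB; rewrite finset.in_setU [in X in _ || X]inE uB orbT.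
apply: (@lt_le_trans _ _ (lam + eps)%:E); first by rewrite lte_fin ltrDl.
apply: var_eigenvalue_ge gap.
- exact: constraint_continuous.
- exact: constraintN.
rewrite card_constraint_index; apply: leq_ltn_trans In.
rewrite -addnA leq_add2l; apply: leq_trans (leq_card_setU _ _) _.
by rewrite leq_add2l /nonzero_comps /n_comp_mem cardsE.
Qed.

(** By monotonicity and the jump at [k], no index below [k] carries the value
    [lambda k]; distinct indices from [k] on that number the multiplicity
    must reach at least [k + mult - 1]. *)
Lemma mult_last_index (k : nat) : (1 <= k <= #|V|)%N ->
  (k = 1%N \/ (lambda k.-1 < lambda k)%E) ->
  exists2 n, lambda n = lambda k &
    (k + var_mult e omega rho kappa p (lambda k) <= n.+1)%N.
Proof.
move=> /andP[k1 kV] step; set m := var_mult _ _ _ _ _ _.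
pose S := finset (fun i : 'I_#|V| => lambda i.+1 == lambda k).
have Sk (i : 'I_#|V|) : i \in S -> (k <= i.+1)%N.
  rewrite inE => /eqP Ei; case: step => [->//|step].
  rewrite leqNgt; apply/negP => ik; move: step; rewrite -Ei ltNge.
  by rewrite var_eigenvalue_mono// -ltnS prednK.
have [i iS ki] : exists2 i, i \in S & (k + m <= i.+2)%N; last first.
  by exists i.+1 => //; apply/eqP; move: iS; rewrite inE.
apply: contrapT => none.
have kV' : (k.-1 < #|V|)%N by rewrite prednK.
have kS : Ordinal kV' \in S.
  by rewrite inE /= prednK.
have : (#|S| <= m.-1)%N.
  rewrite cardE -(size_map val) -(size_iota k.-1 m.-1).
  apply: uniq_leq_size; first by rewrite map_inj_uniq ?enum_uniq//; exact: val_inj.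
  move=> j /mapP[i]; rewrite mem_enum => iS ->; rewrite mem_iota /=.
  have : (k <= i.+1)%N by exact: Sk.
  have : ~~ (k + m <= i.+2)%N.
    by apply/negP => h; apply: none; exists i.
  case: i {iS} => i iV /=; move: k1; clear; lia.
have : (0 < #|S|)%N by apply/card_gt0P; exists (Ordinal kV').
by rewrite -/m -[#|S|]/m; case: (m) => //; rewrite /= => n; rewrite ltnn.
Qed.

End Minimax.

(** * Nodal domain counts *)

Theorem theorem3p10 (R : realType) (V : finType) (e : rel V)
    (omega : V -> V -> R) (rho kappa : V -> R) (p : R)
    (e_sym : symmetric e) (e_irr : irreflexive e)
    (e_conn : connected_graph e)
    (omega_sym : forall u v, e u v -> omega u v = omega v u)
    (omega_gt0 : forall u v, e u v -> 0 < omega u v)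
    (rho_gt0 : forall u, 0 < rho u)
    (p_gt1 : 1 < p) :
  let lambda := var_eigenvalue e omega rho kappa p in
  let mult := var_mult e omega rho kappa p in
  let beta : int := (edge_count e)%:Z - #|V|%:Z + 1 in
  let nu f : int := (nodal_count e f)%:Z in
  let l f : int := sign_loops e f in
  let z f : int := (zero_count f)%:Z in
  let c f : int := (nonzero_comps e f)%:Z in
  let beta' f : int := nonzero_loops e f in
  (forall (f : V -> R) (lam : R) (k : nat),
     (1 <= k <= #|V|)%N ->
     eigenpair e omega rho kappa p f lam ->
     (lambda k < lam%:E)%E ->
     k%:Z - beta + l f - z f < nu f /\
     k%:Z - beta' f + l f - z f + c f <= nu f) /\
  (forall (f : V -> R) (lam : R) (k m : nat),
     (1 <= k <= #|V|)%N ->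
     eigenpair e omega rho kappa p f lam ->
     lam%:E = lambda k ->
     (k = 1%N \/ (lambda k.-1 < lambda k)%E) ->
     mult (lambda k) = m ->
     k%:Z + m%:Z - 1 - beta' f + l f - z f <= nu f).
Proof.
move=> lambda mult beta nu l z c beta'.
split=> [f lam k kV eig lam_gt|f lam k m kV eig lamE step multE].
  have kle := lt_eigenvalue_index_le e_sym omega_sym omega_gt0 rho_gt0 p_gt1 eig lam_gt.
  have bound : k%:Z - beta' f + l f - z f + c f <= nu f by exact: nodal_bound.
  have loops : beta' f - c f < beta by exact: loops_le_beta eig.1.
  by split=> //; move: bound loops; lia.
have [n nE kn] := mult_last_index kV step.
have nle : (n <= #|sign_changes e f| + zero_count f + nonzero_comps e f)%N.
  apply: (le_eigenvalue_index_le e_sym omega_sym omega_gt0 rho_gt0 p_gt1 eig).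
  by rewrite nE lamE.
have cond : k%:Z + m%:Z - 1 - c f <= (#|sign_changes e f| + zero_count f)%:Z.
  rewrite /c; move: kn nle; rewrite -[var_mult _ _ _ _ _ _]/(mult (lambda k)).
  by rewrite multE; clear; lia.
have := nodal_bound e_sym cond.
rewrite -/(beta' f) -/(l f) -/(z f) -/(c f) -/(nu f); lia.
Qed.
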